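(* Let $\Sigma$ be a finite set with at least two elements. Then the Büchi topology on $T_\Sigma^\omega$ is not metrizable (and hence not Polish).
   Context: $T_\Sigma^\omega$ is the set of maps $\{l,r\}^*\to\Sigma$ (infinite binary $\Sigma$-labelled trees). A Büchi tree automaton is $(\Sigma,Q,q_0,Q_f,\Delta)$ with $\Delta\subseteq Q\times\Sigma\times Q\times Q$; a run on $t$ is $\rho:\{l,r\}^*\to Q$ with $\rho(\text{root})=q_0$ and $(\rho(u),t(u),\rho(ul),\rho(ur))\in\Delta$; it is accepting if along every infinite branch some state of $Q_f$ occurs infinitely often; the automaton accepts the trees having an accepting run. The Büchi topology on $T_\Sigma^\omega$ is the topology generated by the tree languages accepted by Büchi tree automata. *)

(* Defs.v *)
From Stdlib Require Import Reals List.
Open Scope R_scope.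

(** Directions and nodes: a node is a word over {l,r}; the children of u are
    u ++ [l] and u ++ [r]. *)
Inductive dir : Type := dl | dr.

Definition tree (Sigma : Type) : Type := list dir -> Sigma.

Definition finite_type (X : Type) : Prop := exists l : list X, forall x, In x l.

Definition branch_prefix (b : nat -> dir) (n : nat) : list dir :=
  map b (seq 0 n).

Definition is_run {Sigma Q : Type} (q0 : Q) (Delta : Q -> Sigma -> Q -> Q -> Prop)
  (t : tree Sigma) (rho : list dir -> Q) : Prop :=
  rho nil = q0 /\
  forall u, Delta (rho u) (t u) (rho (u ++ dl :: nil)) (rho (u ++ dr :: nil)).

Definition buchi_accepting {Q : Type} (Qf : Q -> Prop) (rho : list dir -> Q) : Prop :=
  forall b : nat -> dir, forall n : nat, exists m : nat,
    (n <= m)%nat /\ Qf (rho (branch_prefix b m)).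

Definition buchi_accepts {Sigma Q : Type} (q0 : Q) (Qf : Q -> Prop)
  (Delta : Q -> Sigma -> Q -> Q -> Prop) (t : tree Sigma) : Prop :=
  exists rho, is_run q0 Delta t rho /\ buchi_accepting Qf rho.

Definition buchi_recognizable (Sigma : Type) (L : tree Sigma -> Prop) : Prop :=
  exists (Q : Type) (q0 : Q) (Qf : Q -> Prop) (Delta : Q -> Sigma -> Q -> Q -> Prop),
    finite_type Q /\ forall t, L t <-> buchi_accepts q0 Qf Delta t.

Inductive generated_open {X : Type} (B : (X -> Prop) -> Prop) : (X -> Prop) -> Prop :=
  | go_basic : forall U, B U -> generated_open B U
  | go_full : generated_open B (fun _ => True)
  | go_inter : forall U V, generated_open B U -> generated_open B V ->
      generated_open B (fun x => U x /\ V x)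
  | go_union : forall F : (X -> Prop) -> Prop,
      (forall U, F U -> generated_open B U) ->
      generated_open B (fun x => exists U, F U /\ U x)
  | go_ext : forall U V, generated_open B U -> (forall x, U x <-> V x) ->
      generated_open B V.

Definition buchi_open (Sigma : Type) : (tree Sigma -> Prop) -> Prop :=
  generated_open (buchi_recognizable Sigma).

Definition is_metric {X : Type} (d : X -> X -> R) : Prop :=
  (forall x y, 0 <= d x y) /\
  (forall x y, d x y = 0 <-> x = y) /\
  (forall x y, d x y = d y x) /\
  (forall x y z, d x z <= d x y + d y z).

Definition metric_open {X : Type} (d : X -> X -> R) (U : X -> Prop) : Prop :=
  forall x, U x -> exists eps, 0 < eps /\ forall y, d x y < eps -> U y.

Definition metrizable {X : Type} (opens : (X -> Prop) -> Prop) : Prop :=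
  exists d : X -> X -> R, is_metric d /\ forall U, opens U <-> metric_open d U.

(* Main.v *)
Require Import Defs.
From Stdlib Require Import Reals List Lia Lra Arith Cantor ClassicalEpsilon
  FunctionalExtensionality.

(** Let [L] be the set of trees having a branch with infinitely many [a]'s; it
    is open, being Büchi recognizable.  In a metric space closed sets are
    G-delta, and there are only countably many Büchi languages, so metrizability
    would make the complement of [L] a countable intersection of countable
    unions of finite intersections of Büchi languages.  Büchi languages are
    analytic, hence the complement of [L] would be analytic: [~ L t] iff some
    [y : nat -> nat] satisfies [C t y], with [C] closed.  Now define a tree [t]
    by recursion on the depth: [t u = a] iff [u] codes some [y 0, .., y (n-1)]
    which, together with the part of [t] above depth [n], can be extended to a
    point of [C].  Branches of [t] with infinitely many [a]'s then correspond to
    the [y] with [C t y], so [L t] iff [~ L t]. *)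

Local Open Scope nat_scope.

(** * Branches *)

Lemma branch_prefix_S (b : nat -> dir) (n : nat) :
  branch_prefix b (S n) = branch_prefix b n ++ b n :: nil.
Proof. unfold branch_prefix. rewrite seq_S, map_app. reflexivity. Qed.

Lemma branch_prefix_length (b : nat -> dir) (n : nat) :
  length (branch_prefix b n) = n.
Proof. unfold branch_prefix. now rewrite length_map, length_seq. Qed.

Lemma branch_prefix_add (b : nat -> dir) (n k : nat) :
  exists x, branch_prefix b (n + k) = branch_prefix b n ++ x.
Proof.
  unfold branch_prefix. rewrite seq_app, map_app. eauto.
Qed.

Lemma follow_branch (P : list dir -> Prop) :
  P nil -> (forall u, P u -> exists d, P (u ++ d :: nil)) ->
  exists b, forall n, P (branch_prefix b n).
Proof.
  intros H0 HS.
  set (next := fun u => epsilon (inhabits dl) (fun d => P (u ++ d :: nil))).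
  set (path := nat_rect (fun _ => list dir) nil (fun _ u => u ++ next u :: nil)).
  exists (fun m => next (path m)).
  assert (Hpath : forall n, branch_prefix (fun m => next (path m)) n = path n).
  { induction n as [|n IH]; [reflexivity|].
    rewrite branch_prefix_S, IH. reflexivity. }
  intro n. rewrite Hpath. induction n as [|n IH]; [exact H0|].
  exact (epsilon_spec (inhabits dl) (fun d => P (path n ++ d :: nil)) (HS _ IH)).
Qed.

Lemma app_inj_length {X : Type} (u v x y : list X) :
  u ++ x = v ++ y -> length u = length v -> u = v.
Proof.
  revert v. induction u as [|c u IH]; intros [|c' v] H Hl; simpl in *;
    try discriminate; [reflexivity|].
  injection H as -> H. f_equal. apply IH; [exact H | lia].
Qed.

(** * Ranks witnessing Büchi acceptance *)

(** A branch-free form of: every path from [u] meets [P] within [k] steps. *)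
Fixpoint hits_within (P : list dir -> Prop) (k : nat) (u : list dir) : Prop :=
  P u \/
  match k with
  | 0 => False
  | S k => hits_within P k (u ++ dl :: nil) /\ hits_within P k (u ++ dr :: nil)
  end.

Lemma hits_within_le (P : list dir -> Prop) (k k' : nat) (u : list dir) :
  k <= k' -> hits_within P k u -> hits_within P k' u.
Proof.
  revert k' u. induction k as [|k IH]; intros [|k'] u Hle H; simpl in *;
    try lia; try tauto.
  destruct H as [H|[H1 H2]]; [tauto|].
  right. split; apply IH; (lia || assumption).
Qed.

(** König's lemma: a node without a bound has a child without one, and following such children gives
    a branch that avoids [P] from [u] on. *)
Lemma konig_hits (P : list dir -> Prop) :
  (forall b n, exists m, n <= m /\ P (branch_prefix b m)) ->
  forall u, exists k, hits_within P k u.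
Proof.
  intros Hacc u. apply NNPP. intro Hbad.
  (* The branch must start at the root, so it first descends to [u] and only then follows unbounded
     nodes. *)
  destruct (follow_branch (fun v => exists w,
    v ++ w = u \/ (v = u ++ w /\ ~ exists k, hits_within P k v))) as [b Hb].
  - exists u. now left.
  - assert (Hstep : forall v, (~ exists k, hits_within P k v) ->
      exists d, ~ exists k, hits_within P k (v ++ d :: nil)).
    { intros v Hv. apply NNPP. intro Hno. apply Hv.
      destruct (classic (exists k, hits_within P k (v ++ dl :: nil))) as [[k Hk]|H];
        [|exfalso; apply Hno; now exists dl].
      destruct (classic (exists k, hits_within P k (v ++ dr :: nil))) as [[k' Hk']|H];
        [|exfalso; apply Hno; now exists dr].
      exists (S (k + k')). right.
      split; eapply hits_within_le; [|exact Hk| |exact Hk']; lia. }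
    intros v [w [Hw|[Hw Hv]]].
    + destruct w as [|d w].
      * rewrite app_nil_r in Hw. subst v.
        destruct (Hstep u Hbad) as [d Hd]. exists d, (d :: nil). right. now split.
      * exists d, w. left. now rewrite <- app_assoc.
    + destruct (Hstep v Hv) as [d Hd]. exists d, (w ++ d :: nil). right.
      split; [|exact Hd]. now rewrite Hw, <- app_assoc.
  - destruct (Hacc b (S (length u))) as [m [Hm HP]].
    destruct (Hb m) as [w [Hw|[_ Hv]]].
    + apply (f_equal (@length dir)) in Hw.
      rewrite length_app, branch_prefix_length in Hw. lia.
    + apply Hv. exists 0. now left.
Qed.

(** Replaces the quantifier over branches by one existential rank checked locally at each node. The
    rank is the least bound of [hits_within]; conversely, a rank cannot decrease forever along a
    branch. *)
Lemma buchi_accepting_rank {Q : Type} (Qf : Q -> Prop) (rho : list dir -> Q) :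
  buchi_accepting Qf rho <->
  exists r : list dir -> nat, forall u, Qf (rho u) \/
    (r (u ++ dl :: nil) < r u /\ r (u ++ dr :: nil) < r u).
Proof.
  split.
  - intro Hacc.
    set (P := fun u => Qf (rho u)).
    assert (Hr : forall u, exists k, hits_within P k u /\
      forall j, hits_within P j u -> k <= j).
    { intro u.
      destruct (dec_inh_nat_subset_has_unique_least_element
        (fun k => hits_within P k u)) as [k [Hk _]].
      - intro n. apply classic.
      - apply konig_hits. exact Hacc.
      - exists k. exact Hk. }
    apply choice in Hr. destruct Hr as [r Hr]. exists r. intro u.
    destruct (Hr u) as [Hu _]. destruct (r u) as [|k]; destruct Hu as [Hu|Hu];
      [now left | contradiction | now left | right].
    split; apply Nat.lt_succ_r; apply Hr; apply Hu.
  - intros [r Hr] b n.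
    remember (r (branch_prefix b n)) as k eqn:Hk.
    revert n Hk. induction k as [k IH] using lt_wf_ind. intros n Hk.
    destruct (Hr (branch_prefix b n)) as [Hf|[Hl Hrr]]; [exists n; auto|].
    assert (Hlt : r (branch_prefix b (S n)) < k).
    { rewrite branch_prefix_S. destruct (b n); lia. }
    destruct (IH _ Hlt (S n) eq_refl) as [m [Hm HQ]].
    exists m. split; [lia | exact HQ].
Qed.

(** * Analytic sets of trees *)

(** Closedness in the product of the tree space and Baire space, both with discrete values: a point
    approximated to every finite depth belongs to [C]. *)
Definition closed_rel {Sigma : Type} (C : tree Sigma -> (nat -> nat) -> Prop) : Prop :=
  forall t y,
    (forall n, exists t' y', (forall u, length u < n -> t' u = t u) /\
      (forall k, k < n -> y' k = y k) /\ C t' y') ->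
    C t y.

Definition analytic {Sigma : Type} (U : tree Sigma -> Prop) : Prop :=
  exists C, closed_rel C /\ forall t, U t <-> exists y, C t y.

Lemma analytic_ext {Sigma : Type} (U V : tree Sigma -> Prop) :
  (forall t, U t <-> V t) -> analytic U -> analytic V.
Proof.
  intros H [C [HC HU]]. exists C. split; [exact HC|].
  intro t. now rewrite <- H.
Qed.

Lemma analytic_guard {Sigma : Type} (P : Prop) (U : tree Sigma -> Prop) :
  analytic U -> analytic (fun t => P -> U t).
Proof.
  intros [C [HC HU]]. exists (fun t y => P -> C t y). split.
  - intros t y H p. apply HC. intro n.
    destruct (H n) as (t' & y' & H1 & H2 & H3). exists t', y'. auto.
  - intro t. split.
    + intro H. destruct (classic P) as [p|np].
      * destruct (proj1 (HU t) (H p)) as [y Hy]. exists y. auto.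
      * exists (fun _ => 0). tauto.
    + intros [y Hy] p. apply HU. exists y. auto.
Qed.

Lemma analytic_and_const {Sigma : Type} (P : Prop) (U : tree Sigma -> Prop) :
  analytic U -> analytic (fun t => P /\ U t).
Proof.
  intros [C [HC HU]]. exists (fun t y => P /\ C t y). split.
  - intros t y H. split; [destruct (H 0) as (? & ? & ? & ? & ? & ?); assumption|].
    apply HC. intro n.
    destruct (H n) as (t' & y' & H1 & H2 & _ & H3). exists t', y'. auto.
  - intro t. rewrite HU. firstorder.
Qed.

Lemma bounded_below (f : nat -> nat) (n : nat) :
  exists N, n <= N /\ forall k, k < n -> f k < N.
Proof.
  induction n as [|n [N [HN IH]]].
  - exists 0. split; lia.
  - exists (S (N + f n)). split; [lia|]. intros k Hk.
    destruct (Nat.eq_dec k n) as [->|Hne]; [lia|].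
    specialize (IH k). lia.
Qed.

(** One sequence packs countably many witnesses as rows through Cantor pairing. *)
Lemma analytic_inter {Sigma : Type} (U : nat -> tree Sigma -> Prop) :
  (forall n, analytic (U n)) -> analytic (fun t => forall n, U n t).
Proof.
  intro HU. apply choice in HU. destruct HU as [C HC].
  exists (fun t y => forall n, C n t (fun k => y (Cantor.to_nat (n, k)))). split.
  - intros t y H m. apply HC. intro n.
    destruct (bounded_below (fun k => Cantor.to_nat (m, k)) n) as [N [HN Hb]].
    destruct (H N) as (t' & y' & H1 & H2 & H3).
    exists t', (fun k => y' (Cantor.to_nat (m, k))).
    repeat split; [|intros k Hk; apply H2, Hb, Hk | apply H3].
    intros u Hu. apply H1. lia.
  - intro t. split.
    + intro H.
      assert (Hy : forall n, exists y, C n t y) by (intro n; apply HC, H).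
      apply choice in Hy. destruct Hy as [y Hy].
      exists (fun i => let (n, k) := Cantor.of_nat i in y n k).
      intro n. replace (fun k : nat => _) with (y n); [apply Hy|].
      apply functional_extensionality. intro k. now rewrite Cantor.cancel_of_to.
    + intros [y Hy] n. apply HC. eauto.
Qed.

(** Entry 0 of the witness names the index and the rest is a witness for that set. Agreement on
    entry 0 pins down which closed relation is approximated. *)
Lemma analytic_union {Sigma : Type} (U : nat -> tree Sigma -> Prop) :
  (forall n, analytic (U n)) -> analytic (fun t => exists n, U n t).
Proof.
  intro HU. apply choice in HU. destruct HU as [C HC].
  exists (fun t y => C (y 0) t (fun k => y (S k))). split.
  - intros t y H. apply HC. intro n.
    destruct (H (S n)) as (t' & y' & H1 & H2 & H3).
    exists t', (fun k => y' (S k)). repeat split.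
    + intros u Hu. apply H1. lia.
    + intros k Hk. apply H2. lia.
    + rewrite <- (H2 0); [exact H3 | lia].
  - intro t. split.
    + intros [n Hn]. apply HC in Hn. destruct Hn as [y Hy].
      exists (fun k => match k with 0 => n | S k => y k end). exact Hy.
    + intros [y Hy]. exists (y 0). apply HC. eauto.
Qed.

(** * Büchi languages are analytic *)

(** Letters are binary digits; the 1 at [nil] is the leading digit that makes the code injective. *)
Fixpoint node_code (u : list dir) : nat :=
  match u with
  | nil => 1
  | dl :: u => 2 * node_code u
  | dr :: u => S (2 * node_code u)
  end.

Lemma node_code_pos (u : list dir) : 0 < node_code u.
Proof. induction u as [|[] u IH]; simpl; lia. Qed.

Lemma node_code_inj (u v : list dir) : node_code u = node_code v -> u = v.
Proof.
  revert v. induction u as [|[] u IH]; intros [|[] v] H; simpl in H;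
    try pose proof (node_code_pos u); try pose proof (node_code_pos v);
    try reflexivity; try lia; f_equal; apply IH; lia.
Qed.

Lemma left_inverse {X : Type} (x0 : X) (f : X -> nat) :
  (forall x y, f x = f y -> x = y) -> exists g, forall x, g (f x) = x.
Proof.
  intro Hf. exists (fun n => epsilon (inhabits x0) (fun x => f x = n)).
  intro x. apply Hf.
  apply (epsilon_spec (inhabits x0) (fun z => f z = f x)). now exists x.
Qed.

(** The witness stores a run in row 0 and a rank in row 1. Run and rank conditions are local, each
    reading finitely many values, so the relation is closed. *)
Lemma buchi_analytic {Sigma : Type} (q0 : nat) (Qf : nat -> Prop)
  (Delta : nat -> Sigma -> nat -> nat -> Prop) :
  analytic (buchi_accepts q0 Qf Delta).
Proof.
  set (st := fun (y : nat -> nat) u => y (Cantor.to_nat (0, node_code u))).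
  set (rk := fun (y : nat -> nat) u => y (Cantor.to_nat (1, node_code u))).
  exists (fun t y => is_run q0 Delta t (st y) /\
    forall u, Qf (st y u) \/
      (rk y (u ++ dl :: nil) < rk y u /\ rk y (u ++ dr :: nil) < rk y u)).
  split.
  - intros t y H.
    assert (Hst : forall n u y', (forall k, k < n -> y' k = y k) ->
      Cantor.to_nat (0, node_code u) < n -> st y' u = st y u)
      by (intros n u y' Hy Hn; apply Hy, Hn).
    assert (Hrk : forall n u y', (forall k, k < n -> y' k = y k) ->
      Cantor.to_nat (1, node_code u) < n -> rk y' u = rk y u)
      by (intros n u y' Hy Hn; apply Hy, Hn).
    clearbody st rk.
    split; [split|].
    + destruct (H (S (Cantor.to_nat (0, node_code nil))))
        as (t' & y' & Ht & Hy & [[H0 _] _]).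
      rewrite <- (Hst _ _ _ Hy); [exact H0 | lia].
    + intro u.
      (* Precision beyond the depth of [u] and all codes read by the transition at [u]. *)
      destruct (H (S (length u + Cantor.to_nat (0, node_code u)
        + Cantor.to_nat (0, node_code (u ++ dl :: nil))
        + Cantor.to_nat (0, node_code (u ++ dr :: nil)))))
        as (t' & y' & Ht & Hy & [[_ HD] _]).
      specialize (HD u).
      rewrite !(Hst _ _ _ Hy), Ht in HD; [exact HD | lia..].
    + intro u.
      destruct (H (S (Cantor.to_nat (0, node_code u)
        + Cantor.to_nat (1, node_code u)
        + Cantor.to_nat (1, node_code (u ++ dl :: nil))
        + Cantor.to_nat (1, node_code (u ++ dr :: nil)))))
        as (t' & y' & Ht & Hy & [_ HR]).
      specialize (HR u).
      rewrite (Hst _ _ _ Hy), !(Hrk _ _ _ Hy) in HR; [exact HR | lia..].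
  - intro t. split.
    + intros [rho [[H0 HD] Hacc]]. apply buchi_accepting_rank in Hacc.
      destruct Hacc as [r Hr].
      destruct (left_inverse nil node_code node_code_inj) as [g Hg].
      exists (fun i => let (e, k) := Cantor.of_nat i in
        match e with 0 => rho (g k) | _ => r (g k) end).
      unfold is_run, st, rk.
      split; [split|]; intros; rewrite !Cantor.cancel_of_to, !Hg; auto.
    + intros [y [Hrun HR]]. exists (st y). split; [exact Hrun|].
      apply buchi_accepting_rank. now exists (rk y).
Qed.

(** * Countably many Büchi languages *)

Lemma finite_type_inj (X : Type) : finite_type X ->
  exists j : X -> nat, forall x y, j x = j y -> x = y.
Proof.
  intros [l Hl].
  destruct (choice (fun x n => nth_error l n = Some x)) as [j Hj].
  - intro x. apply In_nth_error, Hl.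
  - exists j. intros x y Hxy. pose proof (Hj x) as Hx.
    rewrite Hxy, Hj in Hx. congruence.
Qed.

Lemma finite_type_prod (X Y : Type) :
  finite_type X -> finite_type Y -> finite_type (X * Y).
Proof.
  intros [l Hl] [m Hm]. exists (list_prod l m). intros [x y]. now apply in_prod.
Qed.

(** Encodes a finite set of naturals by the binary digits of one number, adding [2 ^ c x] by bitwise
    or for each listed [x] in [P]. *)
Lemma finite_image_bits {X : Type} (HX : finite_type X) (P : X -> Prop) (c : X -> nat) :
  exists k, forall n, Nat.testbit k n = true <-> exists x, P x /\ c x = n.
Proof.
  destruct HX as [l Hl].
  assert (H : exists k, forall n,
    Nat.testbit k n = true <-> exists x, In x l /\ P x /\ c x = n).
  { clear Hl. induction l as [|x l [k IH]].
    - exists 0. intro n. rewrite Nat.bits_0. split; [discriminate|].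
      intros [x [[] _]].
    - destruct (classic (P x)) as [Px|nPx].
      + exists (Nat.lor (2 ^ c x) k). intro n.
        rewrite Nat.lor_spec, Bool.orb_true_iff, IH, Nat.pow2_bits_eqb, Nat.eqb_eq.
        split.
        * intros [H|(z & H1 & H2)]; [exists x | exists z]; simpl; auto.
        * intros (z & [->|H1] & H2 & H3); [now left | right; eauto].
      + exists k. intro n. rewrite IH. split.
        * intros (z & H1 & H2). exists z. simpl. auto.
        * intros (z & [->|H1] & H2 & H3); [contradiction | eauto]. }
  destruct H as [k Hk]. exists k. intro n. rewrite Hk.
  split; intros [x Hx]; exists x; [tauto | split; [apply Hl | tauto]].
Qed.

Definition transition_code (q c q1 q2 : nat) : nat :=
  Cantor.to_nat (q, Cantor.to_nat (c, Cantor.to_nat (q1, q2))).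

Lemma transition_code_inj (q c q1 q2 q' c' q1' q2' : nat) :
  transition_code q c q1 q2 = transition_code q' c' q1' q2' ->
  q = q' /\ c = c' /\ q1 = q1' /\ q2 = q2'.
Proof.
  unfold transition_code. intro H.
  apply Cantor.to_nat_inj, pair_equal_spec in H. destruct H as [Hq H].
  apply Cantor.to_nat_inj, pair_equal_spec in H. destruct H as [Hc H].
  apply Cantor.to_nat_inj, pair_equal_spec in H. tauto.
Qed.

(** Finite sets of states and of transitions are coded by the binary digits of
    [f] and [D]; the state set is [nat], but only states occurring in the
    finitely many transitions can appear in a run. *)
Definition coded_lang {Sigma : Type} (s : Sigma -> nat) (i : nat) : tree Sigma -> Prop :=
  let (q0, j) := Cantor.of_nat i in
  let (f, D) := Cantor.of_nat j in
  buchi_accepts q0 (fun q => Nat.testbit f q = true)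
    (fun q c q1 q2 => Nat.testbit D (transition_code q (s c) q1 q2) = true).

Lemma coded_lang_analytic {Sigma : Type} (s : Sigma -> nat) (i : nat) :
  analytic (coded_lang s i).
Proof.
  unfold coded_lang. destruct (Cantor.of_nat i) as [q0 j].
  destruct (Cantor.of_nat j) as [f D]. apply buchi_analytic.
Qed.

(** Renaming states by the injection [j] leaves natural-number data, so the Büchi languages are
    listed by a single index. *)
Lemma buchi_recognizable_coded {Sigma : Type} (HS : finite_type Sigma)
  (s : Sigma -> nat) (Hs : forall c c', s c = s c' -> c = c') (L : tree Sigma -> Prop) :
  buchi_recognizable Sigma L -> exists i, forall t, L t <-> coded_lang s i t.
Proof.
  intros (Q & q0 & Qf & Delta & HQ & HL).
  destruct (finite_type_inj Q HQ) as [j Hj].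
  destruct (finite_image_bits HQ Qf j) as [f Hf].
  destruct (finite_image_bits
    (finite_type_prod _ _ (finite_type_prod _ _ HQ HS) (finite_type_prod _ _ HQ HQ))
    (fun p => Delta (fst (fst p)) (snd (fst p)) (fst (snd p)) (snd (snd p)))
    (fun p => transition_code (j (fst (fst p))) (s (snd (fst p)))
                (j (fst (snd p))) (j (snd (snd p))))) as [D HD].
  exists (Cantor.to_nat (j q0, Cantor.to_nat (f, D))). intro t.
  unfold coded_lang. rewrite !Cantor.cancel_of_to, HL. split.
  - intros [rho [[H0 Hrun] Hacc]]. exists (fun u => j (rho u)). split; [split|].
    + now rewrite H0.
    + intro u. apply HD.
      exists (rho u, t u, (rho (u ++ dl :: nil), rho (u ++ dr :: nil))).
      split; [apply Hrun | reflexivity].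
    + intros b n. destruct (Hacc b n) as [m [Hm HQf]].
      exists m. split; [exact Hm|]. apply Hf. eauto.
  - intros [rho' [[H0 Hrun] Hacc]].
    (* Each node is the source of a transition, and coded transitions only have states in the image
       of [j]. *)
    assert (Hrho : forall u, exists q, j q = rho' u).
    { intro u. specialize (Hrun u). apply HD in Hrun.
      destruct Hrun as (p & _ & Hp). apply transition_code_inj in Hp.
      exists (fst (fst p)). tauto. }
    apply choice in Hrho. destruct Hrho as [rho Hrho].
    exists rho. split; [split|].
    + apply Hj. now rewrite Hrho.
    + intro u. specialize (Hrun u). apply HD in Hrun.
      destruct Hrun as ([[q c] [q1 q2]] & Hd & Hp). simpl in *.
      apply transition_code_inj in Hp. rewrite <- !Hrho in Hp.
      destruct Hp as (Hq & Hc & Hq1 & Hq2).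
      apply Hj in Hq, Hq1, Hq2. apply Hs in Hc. now subst.
    + intros b n. destruct (Hacc b n) as [m [Hm HQf]].
      exists m. split; [exact Hm|]. apply Hf in HQf.
      destruct HQf as [q [Hq Hjq]]. rewrite <- Hrho in Hjq.
      apply Hj in Hjq. now subst.
Qed.

(** [k] codes the finite set of indices of its nonzero binary digits. *)
Definition coded_basic {Sigma : Type} (s : Sigma -> nat) (k : nat) (t : tree Sigma) : Prop :=
  forall i, Nat.testbit k i = true -> coded_lang s i t.

(** Finite intersections of coded languages form a base. As [k] may depend on [t], arbitrary unions
    cost nothing in the induction. *)
Lemma buchi_open_basic {Sigma : Type} (HS : finite_type Sigma)
  (s : Sigma -> nat) (Hs : forall c c', s c = s c' -> c = c') (U : tree Sigma -> Prop) :
  buchi_open Sigma U ->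
  forall t, U t -> exists k, (forall t', coded_basic s k t' -> U t') /\ coded_basic s k t.
Proof.
  intro HU.
  induction HU as [U HU | | U V _ IHU _ IHV | F _ IH | U V _ IH HUV]; intros t Ht.
  - destruct (buchi_recognizable_coded HS s Hs U HU) as [i Hi].
    exists (2 ^ i). split.
    + intros t' H. apply Hi, H, Nat.pow2_bits_true.
    + intros i' H. rewrite Nat.pow2_bits_eqb, Nat.eqb_eq in H. subst i'.
      now apply Hi.
  - exists 0. split; [auto|]. intros i H. now rewrite Nat.bits_0 in H.
  - destruct Ht as [HtU HtV].
    destruct (IHU t HtU) as [k [Hk Hkt]]. destruct (IHV t HtV) as [k' [Hk' Hkt']].
    exists (Nat.lor k k'). split.
    + intros t' H. split; [apply Hk | apply Hk'];
        intros i Hi; apply H; rewrite Nat.lor_spec, Hi; auto using Bool.orb_true_r.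
    + intros i Hi. rewrite Nat.lor_spec, Bool.orb_true_iff in Hi.
      destruct Hi; auto.
  - destruct Ht as [U [HFU HUt]]. destruct (IH U HFU t HUt) as [k [Hk Hkt]].
    exists k. split; [|exact Hkt]. intros t' H. exists U. auto.
  - destruct (IH t) as [k [Hk Hkt]]; [now apply HUV|].
    exists k. split; [|exact Hkt]. intros t' H. apply HUV. auto.
Qed.

(** An open set is the union of the basic sets it contains, and these are countably many; the
    inclusion test does not involve [t], so it acts as a constant conjunct. *)
Lemma buchi_open_analytic {Sigma : Type} (HS : finite_type Sigma) (U : tree Sigma -> Prop) :
  buchi_open Sigma U -> analytic U.
Proof.
  intro HU. destruct (finite_type_inj Sigma HS) as [s Hs].
  apply (analytic_ext (fun t => exists k,
    (forall t', coded_basic s k t' -> U t') /\ coded_basic s k t)).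
  - intro t. split; [intros [k [Hk Ht]]; auto|].
    apply (buchi_open_basic HS s Hs U HU).
  - apply analytic_union. intro k. apply analytic_and_const.
    apply analytic_inter. intro i. apply analytic_guard, coded_lang_analytic.
Qed.

(** * Trees with a branch carrying infinitely many [a]'s *)

Definition inf_branch {Sigma : Type} (a : Sigma) (t : tree Sigma) : Prop :=
  exists b, forall n, exists m, n <= m /\ t (branch_prefix b m) = a.

Lemma inf_branch_buchi {Sigma : Type} (a : Sigma) :
  buchi_recognizable Sigma (inf_branch a).
Proof.
  (* [None] is off the guessed branch; on it, the state records whether the
     label just read is [a]. *)
  exists (option bool), (Some false), (fun q => q <> Some false),
    (fun q c q1 q2 =>
       match q with
       | None => q1 = None /\ q2 = None
       | Some _ => exists e, (e = true <-> c = a) /\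
           ((q1 = Some e /\ q2 = None) \/ (q1 = None /\ q2 = Some e))
       end).
  split.
  { exists (None :: Some true :: Some false :: nil).
    intros [[]|]; simpl; auto. }
  intro t. split.
  - intros [b Hb].
    set (isa := fun n => if excluded_middle_informative (t (branch_prefix b n) = a)
                         then true else false).
    assert (Hisa : forall n, isa n = true <-> t (branch_prefix b n) = a).
    { intro n. unfold isa. destruct excluded_middle_informative; intuition congruence. }
    (* Shifted by one: the state at depth [n + 1] records the label at depth [n]. *)
    set (on := fun n => match n with 0 => false | S n => isa n end).
    set (rho := fun u => if excluded_middle_informative (u = branch_prefix b (length u))
                         then Some (on (length u)) else None).
    assert (Hon : forall n, rho (branch_prefix b n) = Some (on n)).
    { intro n. unfold rho. rewrite branch_prefix_length.
      destruct excluded_middle_informative; congruence. }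
    assert (Hoff : forall u, u <> branch_prefix b (length u) -> rho u = None).
    { intros u Hu. unfold rho. destruct excluded_middle_informative; congruence. }
    assert (Hsnoc : forall u d, u ++ d :: nil = branch_prefix b (length (u ++ d :: nil)) ->
      u = branch_prefix b (length u) /\ d = b (length u)).
    { intros u d Hu. rewrite length_app, Nat.add_1_r, branch_prefix_S in Hu.
      now apply app_inj_tail in Hu. }
    exists rho. split; [split|].
    + apply (Hon 0).
    + intro u.
      destruct (classic (u = branch_prefix b (length u))) as [Hu|Hu].
      * rewrite Hu, (Hon (length u)). set (n := length u).
        assert (Hne : forall d, d <> b n -> rho (branch_prefix b n ++ d :: nil) = None).
        { intros d Hd. apply Hoff. intro H. apply Hsnoc in H.
          rewrite branch_prefix_length in H. tauto. }
        pose proof (Hon (S n)) as HS. rewrite branch_prefix_S in HS.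
        exists (isa n). split; [apply Hisa|].
        destruct (b n); [left | right]; split; auto; apply Hne; discriminate.
      * rewrite (Hoff u Hu). split; apply Hoff; intro H; apply Hsnoc in H; tauto.
    + intros b' n. apply NNPP. intro Hno.
      (* A branch leaving [b] stays in the accepting state [None] from then on, so a failing branch
         coincides with [b]. *)
      assert (Hsame : forall m, branch_prefix b' m = branch_prefix b m).
      { intro m. apply NNPP. intro Hne.
        apply Hno. exists (n + m). split; [lia|].
        rewrite Hoff; [discriminate|]. rewrite branch_prefix_length. intro H.
        destruct (branch_prefix_add b m n) as [x Hx].
        destruct (branch_prefix_add b' m n) as [x' Hx'].
        rewrite Nat.add_comm, Hx, Hx' in H. apply Hne.
        apply (app_inj_length _ _ _ _ H). now rewrite !branch_prefix_length. }
      destruct (Hb n) as [m [Hm Ha]]. apply Hno. exists (S m).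
      split; [lia|]. rewrite Hsame, Hon. simpl. apply Hisa in Ha. congruence.
  - intros [rho [[H0 Hrun] Hacc]].
    destruct (follow_branch (fun u => rho u <> None)) as [b Hb].
    + congruence.
    + intros u Hu. specialize (Hrun u). destruct (rho u); [|congruence].
      destruct Hrun as [e [_ [[H _]|[_ H]]]]; [exists dl | exists dr]; congruence.
    (* [S n] makes up for the shift between a label and the state recording it. *)
    + exists b. intro n. destruct (Hacc b (S n)) as [[|m] [Hm HQ]]; [lia|].
      exists m. split; [lia|]. specialize (Hrun (branch_prefix b m)).
      pose proof (Hb m) as Hbm. pose proof (Hb (S m)) as HbS.
      rewrite branch_prefix_S in HQ, HbS.
      destruct (rho (branch_prefix b m)) as [e0|]; [|congruence].
      destruct Hrun as [e [He Hc]]. apply He.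
      destruct (b m), Hc as [[H1 H2]|[H1 H2]], e; congruence.
Qed.

(** * The diagonal tree *)

(** The label at [u] depends only on smaller depths, so iterates of [F] agree at [u] after more than
    [length u] steps. *)
Lemma causal_fixpoint {Sigma : Type} (c : Sigma) (F : tree Sigma -> tree Sigma) :
  (forall t t' u, (forall v, length v < length u -> t v = t' v) -> F t u = F t' u) ->
  exists t, forall u, t u = F t u.
Proof.
  intro HF.
  set (T := nat_rect (fun _ => tree Sigma) (fun _ => c) (fun _ => F)).
  assert (HT : forall n u m, length u < n -> n <= m -> T n u = T m u).
  { induction n as [|n IH]; intros u [|m] Hu Hm; try lia.
    apply HF. intros v Hv. apply IH; lia. }
  exists (fun u => T (S (length u)) u). intro u.
  apply HF. intros v Hv. symmetry. apply HT; lia.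
Qed.

(** * Sequences of naturals as nodes *)

(** An entry [v] becomes a block of [v] letters [dr] closed by [dl]; these blocks are prefix-free,
    so sequences can be decoded. *)
Definition word_code (s : list nat) : list dir :=
  flat_map (fun v => repeat dr v ++ dl :: nil) s.

Lemma word_code_length (s : list nat) : length s <= length (word_code s).
Proof.
  induction s as [|v s IH]; [reflexivity|].
  change (word_code (v :: s)) with ((repeat dr v ++ dl :: nil) ++ word_code s).
  rewrite !length_app. simpl. lia.
Qed.

Lemma word_code_app (s s' : list nat) : word_code (s ++ s') = word_code s ++ word_code s'.
Proof. apply flat_map_app. Qed.

Lemma word_code_prefix (s s' : list nat) (x x' : list dir) :
  word_code s ++ x = word_code s' ++ x' -> length s <= length s' ->
  exists s'', s' = s ++ s''.
Proof.
  revert s'. induction s as [|v s IH]; intros s' H Hl; [now exists s'|].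
  destruct s' as [|v' s']; simpl in Hl; [lia|].
  assert (Hhead : forall v v' w w', repeat dr v ++ dl :: w = repeat dr v' ++ dl :: w' ->
    v = v' /\ w = w').
  { induction v0 as [|v0 IHv]; intros [|v0'] w w' E; simpl in E; try discriminate.
    - injection E as ->. auto.
    - injection E as E. apply IHv in E. destruct E. auto. }
  unfold word_code in H. simpl in H. rewrite <- !app_assoc in H. simpl in H.
  apply Hhead in H. destruct H as [-> H].
  destruct (IH s' H) as [s'' ->]; [lia|]. now exists s''.
Qed.

Lemma word_code_branch (y : nat -> nat) :
  exists b, forall n, exists m,
    n <= m /\ branch_prefix b m = word_code (map y (seq 0 n)).
Proof.
  assert (Hext : forall n k, exists x,
    word_code (map y (seq 0 (n + k))) = word_code (map y (seq 0 n)) ++ x).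
  { intros n k. rewrite seq_app, map_app, word_code_app. eauto. }
  (* The prefixes of codes of initial segments of [y] form a set without dead ends. *)
  destruct (follow_branch (fun v => exists n w, word_code (map y (seq 0 n)) = v ++ w))
    as [b Hb].
  - exists 0, nil. reflexivity.
  - intros u [n [[|d w] H]].
    + rewrite app_nil_r in H.
      assert (Hn : exists d w, word_code (y n :: nil) = d :: w).
      { destruct (word_code (y n :: nil)) as [|d w] eqn:E; [|eauto].
        pose proof (word_code_length (y n :: nil)) as Hlen.
        rewrite E in Hlen. simpl in Hlen. lia. }
      destruct Hn as (d & w & Hn). exists d, (S n), w.
      rewrite seq_S, map_app, word_code_app, H. simpl map. rewrite Hn.
      now rewrite <- app_assoc.
    + exists d, n, w. now rewrite <- app_assoc.
  - exists b. intro n. set (w := word_code (map y (seq 0 n))).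
    exists (length w). split.
    { pose proof (word_code_length (map y (seq 0 n))) as H.
      now rewrite length_map, length_seq in H. }
    destruct (Hb (length w)) as (k & x & Hk).
    destruct (Hext n k) as [x1 H1]. destruct (Hext k n) as [x2 H2].
    rewrite Nat.add_comm, H1, Hk, <- app_assoc in H2. symmetry in H2.
    apply (app_inj_length _ _ _ _ H2). apply branch_prefix_length.
Qed.

Lemma branch_word_code_comparable (b : nat -> dir) (m m' : nat) (s s' : list nat) :
  branch_prefix b m = word_code s -> branch_prefix b m' = word_code s' ->
  length s <= length s' -> exists s'', s' = s ++ s''.
Proof.
  intros H H' Hl.
  destruct (branch_prefix_add b m m') as [x Hx].
  destruct (branch_prefix_add b m' m) as [x' Hx'].
  rewrite Nat.add_comm, Hx, H, H' in Hx'.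
  now apply word_code_prefix in Hx'.
Qed.

Lemma nth_map_seq (y : nat -> nat) (n k : nat) :
  k < n -> nth k (map y (seq 0 n)) 0 = y k.
Proof.
  intro Hk. rewrite (nth_indep _ 0 (y 0)) by now rewrite length_map, length_seq.
  now rewrite map_nth, seq_nth.
Qed.

(** * Diagonalization against analytic sets *)

Lemma not_inf_branch_not_analytic {Sigma : Type} (a b : Sigma) :
  a <> b -> ~ analytic (fun t => ~ inf_branch a t).
Proof.
  intros Hab [C [HC HU]].
  set (guess := fun (t : tree Sigma) u => exists n t' y,
    u = word_code (map y (seq 0 n)) /\
    (forall v, length v < n -> t' v = t v) /\ C t' y).
  (* A code of [n] entries has length at least [n], so a guess at [u] reads [t] only at depths below
     [length u]. *)
  assert (Hguess : forall t t' u,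
    (forall v, length v < length u -> t v = t' v) -> guess t u -> guess t' u).
  { intros t t' u Ht (n & t1 & y & Hu & H1 & HCy).
    exists n, t1, y. split; [exact Hu|]. split; [|exact HCy].
    intros v Hv. rewrite H1 by exact Hv. apply Ht.
    pose proof (word_code_length (map y (seq 0 n))) as Hlen.
    rewrite <- Hu, length_map, length_seq in Hlen. lia. }
  destruct (causal_fixpoint a
    (fun t u => if excluded_middle_informative (guess t u) then a else b)) as [t Ht].
  { intros t t' u H.
    do 2 destruct excluded_middle_informative as [?|?]; try reflexivity; exfalso; eauto.
    apply n, (Hguess t'); [|assumption]. intros v Hv. symmetry. auto. }
  assert (Hta : forall u, t u = a <-> guess t u).
  { intro u. rewrite Ht. destruct excluded_middle_informative; intuition congruence. }
  assert (Hdiag : inf_branch a t <-> exists y, C t y).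
  { split.
    - intros [br Hbr].
      (* An [a] strictly deeper on the branch codes a strictly longer sequence, so the coded lengths
         are unbounded. *)
      assert (Hlong : forall n, exists m N t' y, n <= N /\
        branch_prefix br m = word_code (map y (seq 0 N)) /\
        (forall v, length v < N -> t' v = t v) /\ C t' y).
      { induction n as [|n (m & N & t1 & y1 & HN & Hm & _)].
        - destruct (Hbr 0) as [m [_ Ha]]. apply Hta in Ha.
          destruct Ha as (N & t' & y & Hu & Ht' & HCy).
          exists m, N, t', y. repeat split; auto. lia.
        - destruct (Hbr (S m)) as [m' [Hm' Ha]]. apply Hta in Ha.
          destruct Ha as (N' & t' & y & Hu & Ht' & HCy).
          exists m', N', t', y. repeat split; auto.
          destruct (le_gt_dec N' N) as [Hle|Hgt]; [|lia]. exfalso.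
          destruct (branch_word_code_comparable _ _ _ _ _ Hu Hm) as [s'' Hs].
          { now rewrite !length_map, !length_seq. }
          rewrite Hs, word_code_app, <- Hu in Hm.
          apply (f_equal (@length dir)) in Hm.
          rewrite length_app, !branch_prefix_length in Hm. lia. }
      apply choice in Hlong. destruct Hlong as [M Hlong].
      apply choice in Hlong. destruct Hlong as [N Hlong].
      apply choice in Hlong. destruct Hlong as [T Hlong].
      apply choice in Hlong. destruct Hlong as [Y Hlong].
      (* Words coded on one branch are comparable, so the guessed sequences agree wherever both are
         coded. *)
      assert (Hcoh : forall i j k, k < N i -> k < N j -> N i <= N j -> Y i k = Y j k).
      { intros i j k Hi Hj Hle.
        destruct (Hlong i) as (_ & Hmi & _). destruct (Hlong j) as (_ & Hmj & _).
        destruct (branch_word_code_comparable _ _ _ _ _ Hmi Hmj) as [s'' Hs].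
        { now rewrite !length_map, !length_seq. }
        rewrite <- (nth_map_seq (Y i) (N i) k Hi), <- (nth_map_seq (Y j) (N j) k Hj), Hs.
        rewrite app_nth1; [reflexivity|]. now rewrite length_map, length_seq. }
      (* [Y (S k)] is read at [k] because [N (S k) >= S k] guarantees that entry [k] is coded. *)
      exists (fun k => Y (S k) k). apply HC. intro n. exists (T n), (Y n).
      destruct (Hlong n) as (HN & _ & HT & HCn).
      repeat split; [|intros k Hk|exact HCn].
      + intros u Hu. apply HT. lia.
      + destruct (Hlong (S k)) as (HNk & _).
        destruct (le_ge_dec (N n) (N (S k))); [|symmetry]; apply Hcoh; lia.
    - intros [y Hy]. destruct (word_code_branch y) as [br Hbr].
      exists br. intro n. destruct (Hbr n) as [m [Hm Hp]].
      (* Along the branch coding [y], the pair of [t] and [y] itself is the required extension. *)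
      exists m. split; [exact Hm|]. apply Hta. exists n, t, y. auto. }
  specialize (HU t). tauto.
Qed.

(** * Non-metrizability of the Büchi topology *)

Theorem theorem4p4 (Sigma : Type) (HSfin : finite_type Sigma)
  (HS2 : exists a b : Sigma, a <> b) :
  ~ metrizable (buchi_open Sigma).
Proof.
  destruct HS2 as (a & b & Hab). intros (d & (Hpos & Hid & Hsym & Htri) & Hopen).
  apply (not_inf_branch_not_analytic a b Hab).
  set (L := inf_branch a).
  assert (HL : metric_open d L) by (apply Hopen, go_basic, inf_branch_buchi).
  (* The open neighbourhoods of radius [1 / (n + 1)] around the complement of [L]; since [L] is
     open, they intersect in that complement. *)
  set (G := fun n t => exists x, ~ L x /\ (d x t < / INR (S n))%R).
  apply (analytic_ext (fun t => forall n, G n t)).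
  - intro t. split.
    + intros HG HLt. destruct (HL t HLt) as [eps [Heps Hball]].
      destruct (archimed_cor1 eps Heps) as [[|n] [Hn Hn0]]; [lia|].
      destruct (HG n) as [x [Hx Hd]]. apply Hx, Hball. rewrite Hsym. lra.
    + intros Ht n. exists t. split; [exact Ht|].
      rewrite (proj2 (Hid t t) eq_refl).
      apply Rinv_0_lt_compat, lt_0_INR. lia.
  - apply analytic_inter. intro n. apply (buchi_open_analytic HSfin), Hopen.
    intros t [x [Hx Hd]]. exists (/ INR (S n) - d x t)%R. split; [lra|].
    intros t' Ht'. exists x. split; [exact Hx|].
    pose proof (Htri x t t'). lra.
Qed.
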